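(* Let $\delta>0$ be a real number and $d$ a positive integer. There exists a positive integer $M(\delta,d)$ with the following property. Let $P(x)=\sum_{k=1}^d\alpha_kx^k$ be a real polynomial of degree $d$ such that for every sufficiently large $N$ and for every $\eta=(\eta_1,\ldots,\eta_N)\in\mathbb R^N$ with $\|\eta\|_\infty\le\delta$ we have \[D_N\bigl(P(1)+\eta_1,P(2)+\eta_2,\ldots,P(N)+\eta_N\bigr)>4\delta.\] Then for all sufficiently large $N$, for every $k\in[1,d]$ there exist integers $p_k,q_k$ with $\gcd(p_k,q_k)=1$, $1\le q_k\le M(\delta,d)$ and \[\Bigl|\alpha_k-\frac{p_k}{q_k}\Bigr|\le N^{-\frac{(k+2)!}{2(d+2)!}}.\]
   Context: For real numbers $x_1,\ldots,x_N$, the discrepancy is $D_N(x_1,\ldots,x_N)=\sup_{I}\bigl|\frac1N\sum_{n=1}^N\chi_I(\{x_n\})-\lambda(I)\bigr|$, where the supremum is over intervals $I=[a,b)\subset[0,1)$, $\chi_I$ is the indicator function of $I$, $\lambda(I)=b-a$, and $\{x\}=x-\lfloor x\rfloor$ is the fractional part. $\|\eta\|_\infty=\max_n|\eta_n|$. *)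

(* Defs.v *)
From Stdlib Require Import Reals ZArith.
From Coquelicot Require Import Coquelicot.
Open Scope R_scope.

Definition ind_frac (a b x : R) : R :=
  if Rle_dec a (frac_part x) then
    if Rlt_dec (frac_part x) b then 1 else 0
  else 0.

Fixpoint count_in (x : nat -> R) (a b : R) (N : nat) : R :=
  match N with
  | O => 0
  | S m => count_in x a b m + ind_frac a b (x N)
  end.

Definition discrepancy (N : nat) (x : nat -> R) : R :=
  real (Lub_Rbar (fun r => exists a b : R,
          0 <= a /\ a <= b /\ b <= 1 /\
          r = Rabs (count_in x a b N / INR N - (b - a)))).

Fixpoint poly_eval (alpha : nat -> R) (d : nat) (x : R) : R :=
  match d with
  | O => 0
  | S m => poly_eval alpha m x + alpha d * x ^ d
  end.

(* Main.v *)
(** Since [N1] may depend on the polynomial, the conclusion forces each [alpha k] to be a rational of denominator at most [M], and already [eta = 0] suffices. By a discrete Fejer kernel, a discrepancy above [4 delta] for arbitrarily large [N] makes some Weyl sum of [h P], with [h] bounded in terms of [delta], larger than [eps N] infinitely often. Van der Corput differencing lowers the degree and shows that the leading coefficient has a bounded denominator; splitting [n] into residue classes modulo that denominator removes the leading monomial, and the lower coefficients follow in turn. *)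

Require Import Defs.
From Stdlib Require Import Reals ZArith Lra Lia Psatz Classical.
From Coquelicot Require Import Coquelicot.
Open Scope R_scope.

(** The denominator bound must depend on [delta] and [d] alone, while every threshold in N may
    depend on the polynomial. The key estimates are therefore dichotomies: either the sums are at
    most [eps * INR N] from some unspecified N on, or an exact integrality [is_int (INR q * a)]
    holds with q below a bound fixed before the polynomial. Exactness is free: a linear phase with
    non-integral slope a has sums bounded by 1/|sin(pi a)|, however close a is to an integer. No
    Diophantine approximation enters, and the final error is zero. The constant 4 comes from proving
    only upper bounds for counts, with relative excess 2 delta: a deficit on [a,b) is an excess on
    [0,a) and [b,1) together. The integral of the kernel is replaced by an average over K grid
    points, so that all of the analysis consists of finite trigonometric sums. *)

(** * Finite real sums *)

Fixpoint rsum (f : nat -> R) (n : nat) : R :=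
  match n with
  | O => 0
  | S m => rsum f m + f m
  end.

Lemma rsum_ext (f g : nat -> R) (n : nat) :
  (forall i, (i < n)%nat -> f i = g i) -> rsum f n = rsum g n.
Proof.
  induction n as [|n IH]; intros Hfg; simpl; [reflexivity|].
  rewrite IH by (intros i Hi; apply Hfg; lia). now rewrite Hfg by lia.
Qed.

Lemma rsum_le (f g : nat -> R) (n : nat) :
  (forall i, (i < n)%nat -> f i <= g i) -> rsum f n <= rsum g n.
Proof.
  induction n as [|n IH]; intros Hfg; simpl; [lra|].
  assert (f n <= g n) by (apply Hfg; lia).
  assert (rsum f n <= rsum g n) by (apply IH; intros i Hi; apply Hfg; lia).
  lra.
Qed.

Lemma rsum_plus (f g : nat -> R) (n : nat) :
  rsum (fun i => f i + g i) n = rsum f n + rsum g n.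
Proof. induction n as [|n IH]; simpl; [ring|rewrite IH; ring]. Qed.

Lemma rsum_scal (a : R) (f : nat -> R) (n : nat) :
  rsum (fun i => a * f i) n = a * rsum f n.
Proof. induction n as [|n IH]; simpl; [ring|rewrite IH; ring]. Qed.

Lemma rsum_const (a : R) (n : nat) : rsum (fun _ => a) n = INR n * a.
Proof. induction n as [|n IH]; [simpl; ring|rewrite S_INR; simpl; rewrite IH; ring]. Qed.

Lemma rsum_delta (k n : nat) :
  rsum (fun l => if Nat.eq_dec k l then 1 else 0) n =
  if lt_dec k n then 1 else 0.
Proof.
  induction n as [|n IH].
  - destruct (lt_dec k 0) as [?|?]; [lia|reflexivity].
  - simpl rsum. rewrite IH.
    destruct (lt_dec k n), (lt_dec k (S n)), (Nat.eq_dec k n); try lia; ring.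
Qed.

Lemma rsum_abs (f : nat -> R) (n : nat) :
  Rabs (rsum f n) <= rsum (fun i => Rabs (f i)) n.
Proof.
  induction n as [|n IH]; simpl; [rewrite Rabs_R0; lra|].
  generalize (Rabs_triang (rsum f n) (f n)); lra.
Qed.

Lemma rsum_abs_le (f : nat -> R) (b : R) (n : nat) :
  (forall i, (i < n)%nat -> Rabs (f i) <= b) -> Rabs (rsum f n) <= INR n * b.
Proof.
  intros Hf. apply Rle_trans with (1 := rsum_abs f n).
  rewrite <- rsum_const. now apply rsum_le.
Qed.

Lemma rsum_nonneg (f : nat -> R) (n : nat) :
  (forall i, (i < n)%nat -> 0 <= f i) -> 0 <= rsum f n.
Proof.
  intros Hf. replace 0 with (rsum (fun _ => 0) n) by (rewrite rsum_const; ring).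
  now apply rsum_le.
Qed.

Lemma rsum_swap (f : nat -> nat -> R) (n m : nat) :
  rsum (fun i => rsum (fun j => f i j) m) n =
  rsum (fun j => rsum (fun i => f i j) n) m.
Proof.
  induction n as [|n IH]; simpl.
  - rewrite rsum_const; ring.
  - rewrite IH, rsum_plus. reflexivity.
Qed.

Lemma rsum_app (f : nat -> R) (n m : nat) :
  rsum f (n + m) = rsum f n + rsum (fun i => f (n + i)%nat) m.
Proof.
  induction m as [|m IH].
  - rewrite Nat.add_0_r; simpl; ring.
  - rewrite Nat.add_succ_r; simpl; rewrite IH; ring.
Qed.

Lemma rsum_succ_l (f : nat -> R) (n : nat) :
  rsum f (S n) = f 0%nat + rsum (fun i => f (S i)) n.
Proof. change (S n) with (1 + n)%nat. rewrite rsum_app. simpl. ring. Qed.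

Lemma rsum_mul (f g : nat -> R) (n : nat) :
  rsum f n * rsum g n = rsum (fun i => rsum (fun j => f i * g j) n) n.
Proof.
  rewrite (rsum_ext (fun i => rsum (fun j => f i * g j) n)
             (fun i => rsum g n * f i)).
  - rewrite rsum_scal; ring.
  - intros i _. rewrite rsum_scal; ring.
Qed.

Lemma rsum_cauchy_schwarz (f : nat -> R) (n : nat) :
  rsum f n ^ 2 <= INR n * rsum (fun i => f i ^ 2) n.
Proof.
  induction n as [|n IH]; [simpl; lra|].
  rewrite S_INR.
  change (rsum f (S n)) with (rsum f n + f n).
  change (rsum (fun i => f i ^ 2) (S n)) with (rsum (fun i => f i ^ 2) n + f n ^ 2).
  assert (Ht : 0 <= rsum (fun i => f i ^ 2) n)
    by (apply rsum_nonneg; intros; apply pow2_ge_0).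
  assert (Hs : INR n = 0 -> rsum f n = 0)
    by (intros H0; apply (INR_eq n 0) in H0; now subst n).
  revert IH Ht Hs. generalize (rsum f n) (rsum (fun i => f i ^ 2) n) (f n).
  intros s t x IH Ht Hs.
  assert (Hn := pos_INR n).
  assert (Hx : 2 * s * x <= t + INR n * x ^ 2).
  { destruct (Req_dec (INR n) 0) as [H0|H0].
    - rewrite (Hs H0), H0. lra.
    - assert (H1 := pow2_ge_0 (s - INR n * x)).
      apply Rmult_le_reg_l with (INR n); [lra|]. lra. }
  lra.
Qed.

(** Sliding the window by h only exchanges h terms at each end. *)
Lemma rsum_shift (g : nat -> R) (h n : nat) :
  (forall i, Rabs (g i) <= 1) ->
  Rabs (rsum (fun i => g (i + h)%nat) n - rsum g n) <= 2 * INR h.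
Proof.
  intros Hg.
  assert (E : rsum (fun i => g (i + h)%nat) n - rsum g n =
              rsum (fun i => g (n + i)%nat) h + - rsum g h).
  { rewrite (rsum_ext (fun i => g (i + h)%nat) (fun i => g (h + i)%nat))
      by (intros; f_equal; lia).
    generalize (rsum_app g n h) (rsum_app g h n).
    rewrite (Nat.add_comm h n). lra. }
  rewrite E.
  generalize (Rabs_triang (rsum (fun i => g (n + i)%nat) h) (- rsum g h)).
  rewrite Rabs_Ropp.
  assert (Rabs (rsum (fun i => g (n + i)%nat) h) <= INR h * 1)
    by (apply rsum_abs_le; auto).
  assert (Rabs (rsum g h) <= INR h * 1) by (apply rsum_abs_le; auto).
  lra.
Qed.

Lemma rsum_residues (g : nat -> R) (q n : nat) :
  rsum g (q * n) = rsum (fun r => rsum (fun m => g (q * m + r)%nat) n) q.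
Proof.
  induction n as [|n IH].
  - rewrite Nat.mul_0_r; simpl. rewrite rsum_const; ring.
  - rewrite Nat.mul_succ_r, rsum_app, IH. simpl. rewrite rsum_plus. reflexivity.
Qed.

Lemma eventually_forall_lt (Q : nat -> nat -> Prop) (H : nat) :
  (forall h, (h < H)%nat -> exists N0, forall N, (N0 <= N)%nat -> Q h N) ->
  exists N0, forall h, (h < H)%nat -> forall N, (N0 <= N)%nat -> Q h N.
Proof.
  induction H as [|H IH]; intros HQ.
  - exists O; intros; lia.
  - destruct IH as [N1 HN1]; [intros h Hh; apply HQ; lia|].
    destruct (HQ H) as [N2 HN2]; [lia|].
    exists (Nat.max N1 N2); intros h Hh N HN.
    destruct (Nat.eq_dec h H) as [->|Hne]; [apply HN2; lia|].
    apply HN1; lia.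
Qed.

Lemma nat_upper_bound (x : R) : exists n : nat, (1 <= n)%nat /\ x <= INR n.
Proof.
  destruct (INR_archimed 1 x) as [n Hn]; [lra|].
  exists (S n); split; [lia|]. rewrite S_INR; lra.
Qed.

(** * Integrality and cosine sums *)

Definition is_int (x : R) : Prop := exists z : Z, x = IZR z.

Lemma is_int_INR (n : nat) : is_int (INR n).
Proof. exists (Z.of_nat n). apply INR_IZR_INZ. Qed.

Lemma is_int_plus (x y : R) : is_int x -> is_int y -> is_int (x + y).
Proof. intros [m ->] [n ->]. exists (m + n)%Z. now rewrite plus_IZR. Qed.

Lemma is_int_opp (x : R) : is_int x -> is_int (- x).
Proof. intros [m ->]. exists (- m)%Z. now rewrite opp_IZR. Qed.

Lemma is_int_mult (x y : R) : is_int x -> is_int y -> is_int (x * y).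
Proof. intros [m ->] [n ->]. exists (m * n)%Z. now rewrite mult_IZR. Qed.

Lemma is_int_opp_iff (x : R) : is_int (- x) -> is_int x.
Proof. intros H. rewrite <- (Ropp_involutive x). now apply is_int_opp. Qed.

Definition cos2pi (x : R) : R := cos (2 * PI * x).

Lemma cos2pi_int (x z : R) : is_int z -> cos2pi (x + z) = cos2pi x.
Proof.
  intros [k ->]. unfold cos2pi.
  destruct (Z_le_gt_dec 0 k) as [Hk|Hk].
  - rewrite <- (Z2Nat.id k Hk), <- INR_IZR_INZ.
    rewrite <- (cos_period (2 * PI * x) (Z.to_nat k)). f_equal. ring.
  - assert (E : IZR k = - INR (Z.to_nat (- k))).
    { rewrite INR_IZR_INZ, Z2Nat.id by lia. rewrite opp_IZR. ring. }
    rewrite E, <- (cos_period (2 * PI * (x + _)) (Z.to_nat (- k))). f_equal. ring.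
Qed.

Lemma cos2pi_bound (x : R) : Rabs (cos2pi x) <= 1.
Proof. unfold cos2pi. apply Rabs_le, COS_bound. Qed.

(** Since 2 sin(A) cos(B) = sin(B + A) - sin(B - A) and consecutive B differ by 2A, the sum
    telescopes. This replaces the geometric series of exponentials. *)
Lemma cos2pi_telescope (a c : R) (n : nat) :
  2 * sin (PI * a) * rsum (fun i => cos2pi (a * INR i + c)) n =
  sin (2 * PI * (a * INR n + c) - PI * a) - sin (2 * PI * c - PI * a).
Proof.
  induction n as [|n IH].
  - simpl. replace (a * 0 + c) with c by ring. ring.
  - simpl rsum. rewrite Rmult_plus_distr_l, IH, S_INR. unfold cos2pi.
    replace (2 * PI * (a * (INR n + 1) + c) - PI * a)
      with (2 * PI * (a * INR n + c) + PI * a) by ring.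
    rewrite sin_plus, !sin_minus. ring.
Qed.

Lemma rsum_cos2pi_linear_bound (a c : R) (n : nat) :
  sin (PI * a) <> 0 ->
  Rabs (rsum (fun i => cos2pi (a * INR i + c)) n) <= / Rabs (sin (PI * a)).
Proof.
  intros Hs. apply Rabs_pos_lt in Hs.
  generalize (cos2pi_telescope a c n).
  set (X := rsum _ n). intros E.
  assert (Hle : Rabs (2 * sin (PI * a) * X) <= 2).
  { rewrite E. apply Rabs_le.
    generalize (SIN_bound (2 * PI * (a * INR n + c) - PI * a))
      (SIN_bound (2 * PI * c - PI * a)). lra. }
  rewrite !Rabs_mult, (Rabs_pos_eq 2) in Hle by lra.
  apply Rmult_le_reg_l with (Rabs (sin (PI * a))); [assumption|].
  rewrite Rinv_r by lra. lra.
Qed.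

Lemma sin_pi_eq_0 (a : R) : sin (PI * a) = 0 -> is_int a.
Proof.
  intros Hs. destruct (sin_eq_0_0 _ Hs) as [k Hk].
  exists k. apply Rmult_eq_reg_l with PI; [lra|]. generalize PI_RGT_0; lra.
Qed.

(** Both sides are |sum e(t_k)|^2: the shift by 1/4 turns the cosine into the sine, so the two
    squares are those of the real and imaginary parts. *)
Lemma rsum_cos2pi_diff (t : nat -> R) (n : nat) :
  rsum (fun k => rsum (fun l => cos2pi (t k - t l)) n) n =
  rsum (fun k => cos2pi (t k)) n ^ 2 + rsum (fun k => cos2pi (t k - / 4)) n ^ 2.
Proof.
  rewrite <- !Rsqr_pow2. unfold Rsqr. rewrite !rsum_mul, <- rsum_plus.
  apply rsum_ext; intros k _. rewrite <- rsum_plus.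
  apply rsum_ext; intros l _. unfold cos2pi.
  replace (2 * PI * (t k - t l)) with (2 * PI * t k - 2 * PI * t l) by ring.
  replace (2 * PI * (t k - / 4)) with (2 * PI * t k - PI / 2) by field.
  replace (2 * PI * (t l - / 4)) with (2 * PI * t l - PI / 2) by field.
  rewrite !cos_minus, cos_PI2, sin_PI2. ring.
Qed.

(** * Weyl sums and the calculus of leading coefficients *)

(* Quantifying over all phases [c] expresses [|sum e(f n)| <= eps N] without complex numbers. *)
Definition small_weyl_sums (f : nat -> R) (eps : R) : Prop :=
  exists N0 : nat, forall N : nat, (N0 <= N)%nat -> forall c : R,
    Rabs (rsum (fun n => cos2pi (f n + c)) N) <= eps * INR N.

(* The coefficient [a] of [n^d] may be zero: [d] only bounds the degree. *)
Fixpoint has_lead (d : nat) (a : R) (f : nat -> R) : Prop :=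
  match d with
  | O => forall n, f n = a
  | S d' => exists b g, has_lead d' b g /\ forall n, f n = a * INR n ^ d + g n
  end.

Lemma has_lead_ext (d : nat) (a : R) (f g : nat -> R) :
  (forall n, f n = g n) -> has_lead d a f -> has_lead d a g.
Proof.
  intros Hfg. destruct d as [|d]; simpl.
  - intros Hf n. now rewrite <- Hfg.
  - intros (b & u & Hu & Hf). exists b, u. split; [assumption|].
    intros n. now rewrite <- Hfg.
Qed.

Lemma has_lead_plus (d : nat) (a b : R) (f g : nat -> R) :
  has_lead d a f -> has_lead d b g -> has_lead d (a + b) (fun n => f n + g n).
Proof.
  revert a b f g. induction d as [|d IH]; simpl; intros a b f g.
  - intros Hf Hg n. now rewrite Hf, Hg.
  - intros (a' & u & Hu & Hf) (b' & v & Hv & Hg).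
    exists (a' + b'), (fun n => u n + v n). split; [now apply IH|].
    intros n. rewrite Hf, Hg. ring.
Qed.

Lemma has_lead_scal (d : nat) (c a : R) (f : nat -> R) :
  has_lead d a f -> has_lead d (c * a) (fun n => c * f n).
Proof.
  revert a f. induction d as [|d IH]; simpl; intros a f.
  - intros Hf n. now rewrite Hf.
  - intros (a' & u & Hu & Hf). exists (c * a'), (fun n => c * u n).
    split; [now apply IH|]. intros n. rewrite Hf. ring.
Qed.

Lemma has_lead_weaken (d : nat) (a : R) (f : nat -> R) :
  has_lead d a f -> has_lead (S d) 0 f.
Proof. intros Hf. exists a, f. split; [assumption|]. intros n. ring. Qed.

Lemma has_lead_mul_linear (d : nat) (a q r : R) (f : nat -> R) :
  has_lead d a f -> has_lead (S d) (a * q) (fun n => f n * (q * INR n + r)).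
Proof.
  revert a f. induction d as [|d IH]; intros a f Hf.
  - exists (a * r), (fun _ => a * r). split; [intros n; reflexivity|].
    intros n. simpl in Hf. rewrite Hf. simpl. ring.
  - destruct Hf as (b & u & Hu & Hf).
    exists (a * r + b * q), (fun n => a * r * INR n ^ S d + u n * (q * INR n + r)).
    split.
    + apply has_lead_plus; [|now apply IH].
      exists 0, (fun _ => 0). split; [|intros n; ring].
      clear. induction d as [|d IH]; [intros n; reflexivity|].
      exists 0, (fun _ => 0). split; [assumption|]. intros n; ring.
    + intros n. rewrite Hf. simpl. ring.
Qed.

Lemma has_lead_linear_pow (d : nat) (q r : R) :
  has_lead d (q ^ d) (fun n => (q * INR n + r) ^ d).
Proof.
  induction d as [|d IH]; [intros n; reflexivity|].
  replace (q ^ S d) with (q ^ d * q) by (simpl; ring).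
  apply has_lead_ext with (2 := has_lead_mul_linear d _ q r _ IH).
  intros n. simpl. ring.
Qed.

(** Restriction to the class of r modulo q. The factor q^d is why integrality is later tested on
    [alpha (S d) * INR q0 ^ S d]. *)
Lemma has_lead_affine (d q r : nat) (a : R) (f : nat -> R) :
  has_lead d a f -> has_lead d (a * INR q ^ d) (fun m => f (q * m + r)%nat).
Proof.
  revert a f. induction d as [|d IH]; intros a f Hf.
  - intros n. simpl in Hf. rewrite Hf. simpl; ring.
  - destruct Hf as (b & u & Hu & Hf).
    replace (a * INR q ^ S d) with (a * INR q ^ S d + 0) by ring.
    apply has_lead_ext with
      (fun m => a * (INR q * INR m + INR r) ^ S d + u (q * m + r)%nat).
    + intros n. now rewrite Hf, plus_INR, mult_INR.
    + apply has_lead_plus.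
      * apply has_lead_scal, has_lead_linear_pow.
      * apply has_lead_weaken with (1 := IH _ _ Hu).
Qed.

(** The recursion x^(d+2) - y^(d+2) = (x^(d+1) - y^(d+1)) x + (x - y) y^(d+1) avoids the binomial
    expansion. *)
Lemma has_lead_diff_pow (d : nat) (h k : R) :
  has_lead d (INR (S d) * (h - k))
    (fun n => (INR n + h) ^ S d - (INR n + k) ^ S d).
Proof.
  induction d as [|d IH].
  - intros n. simpl. ring.
  - apply has_lead_ext with
      (fun n => ((INR n + h) ^ S d - (INR n + k) ^ S d) * (1 * INR n + h)
                + (h - k) * (1 * INR n + k) ^ S d).
    + intros n. rewrite Rmult_1_l. simpl. ring.
    + replace (INR (S (S d)) * (h - k))
        with (INR (S d) * (h - k) * 1 + (h - k) * 1 ^ S d)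
        by (rewrite pow1, (S_INR (S d)); ring).
      apply has_lead_plus.
      * apply has_lead_mul_linear, IH.
      * apply has_lead_scal, has_lead_linear_pow.
Qed.

(** For h <> k the coefficient is a nonzero integer multiple of a, so a denominator for the
    difference yields one for a. *)
Lemma has_lead_diff (d h k : nat) (a : R) (f : nat -> R) :
  has_lead (S d) a f ->
  has_lead d (INR (S d) * (INR h - INR k) * a)
    (fun n => f (n + h)%nat - f (n + k)%nat).
Proof.
  revert a f. induction d as [|d IH]; intros a f (b & u & Hu & Hf).
  - intros n. simpl in Hu. rewrite !Hf, !Hu, !plus_INR. simpl. ring.
  - apply has_lead_ext with
      (fun n => a * ((INR n + INR h) ^ S (S d) - (INR n + INR k) ^ S (S d))
                + (u (n + h)%nat - u (n + k)%nat)).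
    + intros n. rewrite !Hf, !plus_INR. ring.
    + replace (INR (S (S d)) * (INR h - INR k) * a)
        with (a * (INR (S (S d)) * (INR h - INR k)) + 0) by ring.
      apply has_lead_plus.
      * apply has_lead_scal, has_lead_diff_pow.
      * apply has_lead_weaken with (1 := IH _ _ Hu).
Qed.

(** * Van der Corput differencing and the leading coefficient *)

Lemma small_weyl_sums_linear (a b eps : R) (f : nat -> R) :
  0 < eps -> (forall n, f n = a * INR n + b) -> ~ is_int a ->
  small_weyl_sums f eps.
Proof.
  intros Heps Hf Ha.
  assert (Hs : sin (PI * a) <> 0) by (intros Hs; now apply Ha, sin_pi_eq_0).
  destruct (nat_upper_bound (/ Rabs (sin (PI * a)) / eps)) as (N0 & _ & HN0).
  exists N0; intros N HN c.
  rewrite (rsum_ext _ (fun n => cos2pi (a * INR n + (b + c))))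
    by (intros n _; rewrite Hf; f_equal; ring).
  apply Rle_trans with (1 := rsum_cos2pi_linear_bound a (b + c) N Hs).
  apply le_INR in HN.
  apply Rmult_le_reg_r with (/ eps); [now apply Rinv_0_lt_compat|].
  replace (eps * INR N * / eps) with (INR N) by (field; lra).
  unfold Rdiv in HN0. lra.
Qed.

(** Averaging over H shifts gives A close to H S0. Cauchy-Schwarz bounds A^2 by N^2 H^2 (1/H +
    eps^2/8): the 1/H comes from the diagonal h = k, the rest from the differences. The size of H
    makes 1/H at most eps^2/8, hence |A| <= N H eps / 2. *)
Lemma small_weyl_sums_van_der_corput (f : nat -> R) (eps : R) (H : nat) :
  0 < eps -> (1 <= H)%nat -> 8 / eps ^ 2 <= INR H ->
  (forall h k, (h < H)%nat -> (k < H)%nat -> h <> k ->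
     small_weyl_sums (fun n => f (n + h)%nat - f (n + k)%nat) (eps ^ 2 / 8)) ->
  small_weyl_sums f eps.
Proof.
  intros Heps HH1 HH Hsmall.
  destruct (eventually_forall_lt
    (fun h N => forall k, (k < H)%nat -> h <> k -> forall c,
       Rabs (rsum (fun n => cos2pi (f (n + h)%nat - f (n + k)%nat + c)) N)
         <= eps ^ 2 / 8 * INR N) H) as [N1 HN1].
  { intros h Hh.
    destruct (eventually_forall_lt
      (fun k N => h <> k -> forall c,
         Rabs (rsum (fun n => cos2pi (f (n + h)%nat - f (n + k)%nat + c)) N)
           <= eps ^ 2 / 8 * INR N) H) as [N1 HN1].
    - intros k Hk. destruct (Nat.eq_dec h k) as [->|Hne].
      + exists O; intros N _ Hkk; now elim Hkk.
      + destruct (Hsmall h k Hh Hk Hne) as [N1 HN1].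
        exists N1; intros N HN _. now apply HN1.
    - exists N1; intros N HN k Hk Hne. now apply HN1. }
  (* From here on the shift error 2 H^2 is at most half of H eps N. *)
  destruct (nat_upper_bound (4 * INR H / eps)) as (N2 & _ & HN2).
  exists (Nat.max N1 N2); intros N HN c.
  assert (HNN2 : INR N2 <= INR N) by (apply le_INR; lia).
  set (S0 := rsum (fun n => cos2pi (f n + c)) N).
  set (A := rsum (fun n => rsum (fun h => cos2pi (f (n + h)%nat + c)) H) N).
  assert (HHpos : 1 <= INR H) by (apply (le_INR 1); lia).
  assert (HNpos := pos_INR N).
  assert (Hdiff : Rabs (A - INR H * S0) <= INR H * (2 * INR H)).
  { unfold A. rewrite rsum_swap.
    replace (rsum _ H - INR H * S0)
      with (rsum (fun h => rsum (fun n => cos2pi (f (n + h)%nat + c)) N - S0) H).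
    - apply rsum_abs_le; intros h Hh.
      apply Rle_trans with (2 * INR h).
      + apply (rsum_shift (fun n => cos2pi (f n + c))). intros; apply cos2pi_bound.
      + apply lt_INR in Hh; lra.
    - unfold Rminus. rewrite rsum_plus, rsum_const. ring. }
  assert (HA2 : A ^ 2 <= INR N * (INR N * (INR H + INR H * (INR H * (eps ^ 2 / 8))))).
  { apply Rle_trans with (1 := rsum_cauchy_schwarz _ N).
    apply Rmult_le_compat_l; [assumption|].
    apply Rle_trans with
      (rsum (fun n => rsum (fun h => rsum (fun k =>
         cos2pi ((f (n + h)%nat + c) - (f (n + k)%nat + c))) H) H) N).
    { apply rsum_le; intros n _.
      (* The inner square is the real part of a squared modulus; the square of the imaginary part is
         added. *)
      rewrite (rsum_cos2pi_diff (fun h => f (n + h)%nat + c)).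
      generalize (pow2_ge_0 (rsum (fun k => cos2pi (f (n + k)%nat + c - / 4)) H)).
      lra. }
    rewrite rsum_swap.
    replace (INR N * (INR H + INR H * (INR H * (eps ^ 2 / 8))))
      with (rsum (fun h => rsum (fun k =>
              INR N * (if Nat.eq_dec h k then 1 else 0) + INR N * (eps ^ 2 / 8)) H) H).
    - apply rsum_le; intros h Hh. rewrite rsum_swap.
      apply rsum_le; intros k Hk.
      assert (He : 0 <= eps ^ 2 / 8) by nra.
      destruct (Nat.eq_dec h k) as [->|Hne].
      + apply Rle_trans with (INR N * 1); [|nra].
        apply Rle_trans with (1 := Rle_abs _), rsum_abs_le.
        intros; apply cos2pi_bound.
      + apply Rle_trans with (eps ^ 2 / 8 * INR N); [|lra].
        apply Rle_trans with (1 := Rle_abs _).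
        rewrite (rsum_ext _ (fun n => cos2pi (f (n + h)%nat - f (n + k)%nat + 0)))
          by (intros; f_equal; ring).
        apply HN1; trivial; lia.
    - rewrite (rsum_ext _ (fun _ => INR N * 1 + INR H * (INR N * (eps ^ 2 / 8)))).
      + rewrite rsum_const. ring.
      + intros h Hh. rewrite rsum_plus, rsum_const, rsum_scal, rsum_delta.
        destruct (lt_dec h H); [reflexivity|lia]. }
  assert (HHe : 8 <= INR H * eps ^ 2).
  { apply Rmult_le_reg_r with (/ eps ^ 2); [apply Rinv_0_lt_compat; nra|].
    replace (INR H * eps ^ 2 * / eps ^ 2) with (INR H) by (field; lra).
    exact HH. }
  assert (HA : Rabs A <= INR N * INR H * eps / 2).
  { rewrite <- (Rabs_pos_eq (INR N * INR H * eps / 2)).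
    2: { assert (0 <= INR N * INR H) by nra. nra. }
    apply Rsqr_le_abs_0. rewrite !Rsqr_pow2.
    apply Rle_trans with (1 := HA2).
    replace ((INR N * INR H * eps / 2) ^ 2)
      with (INR N ^ 2 * (INR H * (INR H * eps ^ 2 / 4))) by field.
    replace (INR N * (INR N * (INR H + INR H * (INR H * (eps ^ 2 / 8)))))
      with (INR N ^ 2 * (INR H * (1 + INR H * eps ^ 2 / 8))) by field.
    apply Rmult_le_compat_l; [apply pow2_ge_0|].
    apply Rmult_le_compat_l; lra. }
  assert (HNe : 4 * INR H <= eps * INR N).
  { apply Rmult_le_reg_r with (/ eps); [now apply Rinv_0_lt_compat|].
    replace (eps * INR N * / eps) with (INR N) by (field; lra).
    unfold Rdiv in HN2; lra. }
  apply Rmult_le_reg_l with (INR H); [lra|].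
  rewrite <- (Rabs_pos_eq (INR H)) at 1 by lra. rewrite <- Rabs_mult.
  replace (INR H * S0) with (A + - (A - INR H * S0)) by ring.
  apply Rle_trans with (1 := Rabs_triang _ _). rewrite Rabs_Ropp.
  assert (INR H * (4 * INR H) <= INR H * (eps * INR N))
    by (apply Rmult_le_compat_l; lra).
  lra.
Qed.

(** Contraposition at each differencing: a denominator q for (d+2)(h - k)a gives the denominator
    (d+2)|h - k|q for a, whence the factor [S (S d) * H]. Both H and the inductive M are chosen from
    eps and d, before f is given. *)
Lemma weyl_lead (d : nat) (eps : R) :
  0 < eps -> exists M : nat, forall (a : R) (f : nat -> R),
    has_lead (S d) a f ->
    small_weyl_sums f eps \/
    exists q : nat, (1 <= q <= M)%nat /\ is_int (INR q * a).
Proof.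
  revert eps. induction d as [|d IH]; intros eps Heps.
  - exists 1%nat. intros a f (b & g & Hg & Hf).
    destruct (classic (is_int a)) as [Ha|Ha].
    + right. exists 1%nat. split; [lia|]. now rewrite Rmult_1_l.
    + left. apply small_weyl_sums_linear with a b; trivial.
      intros n. simpl in Hg. rewrite Hf, Hg. simpl. ring.
  - destruct (nat_upper_bound (8 / eps ^ 2)) as (H & HH1 & HH).
    destruct (IH (eps ^ 2 / 8)) as [M HM]; [nra|].
    exists (S (S d) * H * M)%nat. intros a f Hf.
    destruct (classic (exists q : nat, (1 <= q <= S (S d) * H * M)%nat /\
                                       is_int (INR q * a))) as [Hq|Hq];
      [now right|left].
    apply small_weyl_sums_van_der_corput with H; trivial.
    intros h k Hh Hk Hne.
    destruct (HM _ _ (has_lead_diff (S d) h k a f Hf)) as [?|(q & Hq1 & Hq2)];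
      [assumption|].
    exfalso. apply Hq.
    destruct (Nat.lt_ge_cases k h) as [Hlt|Hge].
    + exists (S (S d) * (h - k) * q)%nat. split; [split; [nia|]|].
      * apply Nat.mul_le_mono; [apply Nat.mul_le_mono|]; lia.
      * rewrite !mult_INR, minus_INR by lia.
        replace (INR (S (S d)) * (INR h - INR k) * INR q * a)
          with (INR q * (INR (S (S d)) * (INR h - INR k) * a)) by ring.
        assumption.
    + exists (S (S d) * (k - h) * q)%nat. split; [split; [nia|]|].
      * apply Nat.mul_le_mono; [apply Nat.mul_le_mono|]; lia.
      * apply is_int_opp_iff. rewrite !mult_INR, minus_INR by lia.
        replace (- (INR (S (S d)) * (INR k - INR h) * INR q * a))
          with (INR q * (INR (S (S d)) * (INR h - INR k) * a)) by ring.
        assumption.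
Qed.

(** * Periodic perturbations and the lower coefficients *)

Lemma small_weyl_sums_mod1 (f g : nat -> R) (c eps : R) :
  (forall n, is_int (g n - f n - c)) ->
  small_weyl_sums f eps -> small_weyl_sums g eps.
Proof.
  intros Hfg [N0 HN0]. exists N0; intros N HN c'.
  rewrite (rsum_ext _ (fun n => cos2pi (f n + (c + c')))); [now apply HN0|].
  intros n _. rewrite <- (cos2pi_int (f n + (c + c')) _ (Hfg n)). f_equal. ring.
Qed.

(** Full blocks of length q use up one half of eps; the fewer than q leftover terms fit into the
    other half once 2q <= eps N. *)
Lemma small_weyl_sums_residues (f : nat -> R) (q : nat) (eps : R) :
  0 < eps -> (1 <= q)%nat ->
  (forall r, (r < q)%nat -> small_weyl_sums (fun m => f (q * m + r)%nat) (eps / 2)) ->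
  small_weyl_sums f eps.
Proof.
  intros Heps Hq Hr.
  destruct (eventually_forall_lt _ _ Hr) as [N1 HN1].
  destruct (nat_upper_bound (2 * INR q / eps)) as (N2 & _ & HN2).
  exists (q * N1 + N2)%nat; intros N HN c.
  assert (HNN2 : INR N2 <= INR N) by (apply le_INR; lia).
  assert (HNe : 2 * INR q <= eps * INR N).
  { apply Rmult_le_reg_r with (/ eps); [now apply Rinv_0_lt_compat|].
    replace (eps * INR N * / eps) with (INR N) by (field; lra).
    unfold Rdiv in HN2; lra. }
  assert (Hdiv := Nat.div_mod_eq N q).
  assert (Hmod : (N mod q < q)%nat) by (apply Nat.mod_upper_bound; lia).
  assert (HL : (N1 <= N / q)%nat) by (apply Nat.div_le_lower_bound; lia).
  revert Hdiv Hmod HL. generalize (N / q)%nat (N mod q)%nat. intros L s Hdiv Hs HL.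
  assert (HNr : INR N = INR q * INR L + INR s)
    by (rewrite Hdiv, plus_INR, mult_INR; ring).
  rewrite Hdiv at 1. rewrite rsum_app.
  apply Rle_trans with (1 := Rabs_triang _ _).
  assert (H1 : Rabs (rsum (fun n => cos2pi (f n + c)) (q * L)) <=
               INR q * (eps / 2 * INR L)).
  { rewrite rsum_residues. apply rsum_abs_le; intros r Hrq. now apply HN1. }
  assert (H2 : Rabs (rsum (fun i => cos2pi (f (q * L + i)%nat + c)) s) <= INR s * 1)
    by (apply rsum_abs_le; intros; apply cos2pi_bound).
  apply lt_INR in Hs. assert (Hs0 := pos_INR s).
  assert (eps / 2 * (INR q * INR L) <= eps / 2 * INR N)
    by (apply Rmult_le_compat_l; lra).
  lra.
Qed.

Lemma poly_eval_has_lead (alpha : nat -> R) (d : nat) :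
  has_lead (S d) (alpha (S d)) (fun n => poly_eval alpha (S d) (INR n)).
Proof.
  assert (H : exists b, has_lead d b (fun n => poly_eval alpha d (INR n))).
  { induction d as [|d [b IH]].
    - exists 0. intros n. reflexivity.
    - exists (alpha (S d)), b, (fun n => poly_eval alpha d (INR n)).
      split; [assumption|]. intros n. simpl. ring. }
  destruct H as [b Hb].
  exists b, (fun n => poly_eval alpha d (INR n)).
  split; [assumption|]. intros n. simpl. ring.
Qed.

(** The congruence (n + q)^k = n^k modulo q, phrased over the reals: it makes a monomial whose
    coefficient has denominator q periodic modulo 1 with period q. *)
Lemma pow_add_sub_multiple (n q k : nat) :
  exists w, is_int w /\ INR (n + q) ^ k - INR n ^ k = INR q * w.
Proof.
  induction k as [|k (w & Hw & E)].
  - exists 0. split; [exact (is_int_INR 0)|]. simpl; ring.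
  - exists (INR (n + q) * w + INR (n ^ k)). split.
    + apply is_int_plus; [apply is_int_mult; [|assumption]|]; apply is_int_INR.
    + replace (INR (n + q) ^ S k - INR n ^ S k)
        with (INR (n + q) * (INR (n + q) ^ k - INR n ^ k)
              + (INR (n + q) - INR n) * INR n ^ k) by (simpl; ring).
      rewrite E, pow_INR, plus_INR. ring.
Qed.

Lemma is_int_diff_multiple (u : nat -> R) (q : nat) :
  (forall n, is_int (u (n + q)%nat - u n)) ->
  forall m n, is_int (u (q * m + n)%nat - u n).
Proof.
  intros Hu m n. induction m as [|m IH].
  - rewrite Nat.mul_0_r. simpl. rewrite Rminus_diag_eq by reflexivity.
    exact (is_int_INR 0).
  - replace (q * S m + n)%nat with ((q * m + n) + q)%nat by lia.
    replace (u (q * m + n + q)%nat - u n)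
      with ((u (q * m + n + q)%nat - u (q * m + n)%nat)
            + (u (q * m + n)%nat - u n)) by ring.
    now apply is_int_plus.
Qed.

(* The coefficients are treated from the top down: once a leading coefficient is known to be rational, its monomial is periodic modulo 1 and joins [u]. *)
Lemma weyl_poly (d Q : nat) (eps : R) :
  0 < eps -> exists M : nat, forall (alpha u : nat -> R) (q0 : nat),
    (1 <= q0 <= Q)%nat ->
    (forall n, is_int (u (n + q0)%nat - u n)) ->
    small_weyl_sums (fun n => poly_eval alpha d (INR n) + u n) eps \/
    exists q : nat, (1 <= q <= M)%nat /\
      forall k, (1 <= k <= d)%nat -> is_int (INR q * alpha k).
Proof.
  intros Heps. revert Q. induction d as [|d IH]; intros Q.
  - exists 1%nat. intros alpha u q0 _ _. right. exists 1%nat.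
    split; [lia|]. intros k Hk; lia.
  - destruct (weyl_lead d (eps / 2)) as [M1 HM1]; [lra|].
    (* Bound for the period [q0 * q2] of [u] together with the absorbed monomial, where
       [q2 = q1 * q0 ^ S d]. *)
    destruct (IH (Q * (M1 * Q ^ S d))%nat) as [M2 HM2].
    exists (M2 * (M1 * Q ^ S d))%nat. intros alpha u q0 Hq0 Hu.
    destruct (classic (exists q1 : nat, (1 <= q1 <= M1)%nat /\
                is_int (INR q1 * (alpha (S d) * INR q0 ^ S d)))) as [(q1 & Hq1 & Hq1i)|Hno].
    + set (q2 := (q1 * q0 ^ S d)%nat).
      assert (Hpow : (1 <= q0 ^ S d <= Q ^ S d)%nat).
      { split; [|apply Nat.pow_le_mono_l; lia].
        rewrite <- (Nat.pow_1_l (S d)). apply Nat.pow_le_mono_l; lia. }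
      assert (Hq2 : (1 <= q2 <= M1 * Q ^ S d)%nat) by (unfold q2; nia).
      assert (Hq2i : is_int (INR q2 * alpha (S d))).
      { unfold q2. rewrite mult_INR, pow_INR.
        replace (INR q1 * INR q0 ^ S d * alpha (S d))
          with (INR q1 * (alpha (S d) * INR q0 ^ S d)) by ring. assumption. }
      clearbody q2.
      destruct (HM2 alpha (fun n => alpha (S d) * INR n ^ S d + u n) (q0 * q2)%nat)
        as [Hsmall|(q3 & Hq3 & Hq3i)].
      * nia.
      * intros n.
        destruct (pow_add_sub_multiple n (q0 * q2) (S d)) as (w & Hw & E).
        replace (alpha (S d) * INR (n + q0 * q2) ^ S d + u (n + q0 * q2)%nat
                 - (alpha (S d) * INR n ^ S d + u n))
          with (INR q0 * (INR q2 * alpha (S d)) * w + (u (q0 * q2 + n)%nat - u n)).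
        -- apply is_int_plus; [|now apply is_int_diff_multiple].
           apply is_int_mult; [|assumption].
           apply is_int_mult; [apply is_int_INR|assumption].
        -- replace (INR (n + q0 * q2) ^ S d)
             with (INR n ^ S d + INR (q0 * q2) * w) by lra.
           rewrite (Nat.add_comm n), mult_INR. ring.
      * left. apply small_weyl_sums_mod1 with (c := 0) (2 := Hsmall).
        intros n. exists 0%Z.
        change (poly_eval alpha (S d) (INR n))
          with (poly_eval alpha d (INR n) + alpha (S d) * INR n ^ S d). ring.
      * right. exists (q3 * q2)%nat. split; [nia|]. intros k Hk.
        rewrite mult_INR. destruct (Nat.eq_dec k (S d)) as [->|Hne].
        -- rewrite Rmult_assoc. apply is_int_mult; [apply is_int_INR|assumption].
        -- replace (INR q3 * INR q2 * alpha k)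
             with (INR q2 * (INR q3 * alpha k)) by ring.
           apply is_int_mult; [apply is_int_INR|]. apply Hq3i; lia.
    (* On a class modulo [q0] the perturbation is constant modulo 1, so only a polynomial remains,
       and [Hno] excludes every bounded denominator for its leading coefficient. *)
    + left. apply small_weyl_sums_residues with q0; [assumption|lia|].
      intros r Hr.
      apply small_weyl_sums_mod1 with
        (f := fun m => poly_eval alpha (S d) (INR (q0 * m + r))) (c := u r).
      * intros m.
        destruct (is_int_diff_multiple u q0 Hu m r) as [z Hz].
        exists z. rewrite <- Hz. ring.
      * destruct (HM1 _ _ (has_lead_affine _ q0 r _ _ (poly_eval_has_lead alpha d)))
          as [?|?]; [assumption|contradiction].
Qed.

(** * A discrete Fejer kernel majorant for intervals *)

(* [H] times the Fejer kernel. *)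
Definition fejer (H : nat) (y : R) : R :=
  rsum (fun k => rsum (fun l => cos2pi (INR k * y - INR l * y)) H) H.

Lemma fejer_nonneg (H : nat) (y : R) : 0 <= fejer H y.
Proof.
  unfold fejer. rewrite (rsum_cos2pi_diff (fun k => INR k * y)).
  apply Rplus_le_le_0_compat; apply pow2_ge_0.
Qed.

Lemma fejer_bound (H : nat) (y s : R) :
  0 < s <= Rabs (sin (PI * y)) -> fejer H y <= 2 / s ^ 2.
Proof.
  intros [Hs Hsin].
  assert (Hne : sin (PI * y) <> 0)
    by (intros E; rewrite E, Rabs_R0 in Hsin; lra).
  assert (Hb : forall c, rsum (fun k => cos2pi (INR k * y + c)) H ^ 2 <= / s ^ 2).
  { intros c. rewrite <- pow_inv.
    rewrite (rsum_ext _ (fun k => cos2pi (y * INR k + c)))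
      by (intros; f_equal; ring).
    apply pow_maj_Rabs.
    apply Rle_trans with (1 := rsum_cos2pi_linear_bound y c H Hne).
    now apply Rinv_le_contravar. }
  unfold fejer. rewrite (rsum_cos2pi_diff (fun k => INR k * y)).
  assert (H1 := Hb 0). assert (H2 := Hb (- / 4)).
  rewrite (rsum_ext _ (fun k => cos2pi (INR k * y))) in H1
    by (intros; f_equal; ring).
  unfold Rminus, Rdiv. lra.
Qed.

Lemma fejer_int (H : nat) (y z : R) : is_int z -> fejer H (y + z) = fejer H y.
Proof.
  intros Hz. unfold fejer.
  apply rsum_ext; intros k _. apply rsum_ext; intros l _.
  rewrite <- (cos2pi_int (INR k * y - INR l * y) ((INR k - INR l) * z)).
  - f_equal. ring.
  - apply is_int_mult; [|assumption].
    apply is_int_plus; [|apply is_int_opp]; apply is_int_INR.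
Qed.

(** Orthogonality of the characters of Z/K: as 0 < |j| < K, the factor sin(pi j/K) is nonzero, while
    the telescoped difference vanishes over a full period. *)
Lemma rsum_cos2pi_grid (K : nat) (j y : R) :
  is_int j -> 0 < Rabs j < INR K ->
  rsum (fun i => cos2pi (j * (y - INR i / INR K))) K = 0.
Proof.
  intros Hj HjK.
  assert (HK : 0 < INR K) by lra.
  rewrite (rsum_ext _ (fun i => cos2pi (- j / INR K * INR i + j * y)))
    by (intros; f_equal; field; lra).
  assert (Hs : sin (PI * (- j / INR K)) <> 0).
  { intros Hs. destruct (sin_pi_eq_0 _ Hs) as [z Hz].
    assert (Ez : Rabs j = IZR (Z.abs z) * INR K).
    { rewrite abs_IZR, <- Hz.
      rewrite <- (Rabs_pos_eq (INR K)) at 2 by lra.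
      rewrite <- Rabs_mult, <- (Rabs_Ropp j). f_equal. field. lra. }
    destruct (Z.eq_dec z 0) as [->|Hz0].
    - simpl in Ez. lra.
    - assert (1 <= IZR (Z.abs z)) by (apply IZR_le; lia). nra. }
  generalize (cos2pi_telescope (- j / INR K) (j * y) K).
  set (X := rsum _ K).
  replace (2 * PI * (- j / INR K * INR K + j * y) - PI * (- j / INR K))
    with (2 * PI * (j * y + j / INR K / 2 + - j)) by (field; lra).
  replace (2 * PI * (j * y) - PI * (- j / INR K))
    with (2 * PI * (j * y + j / INR K / 2)) by (field; lra).
  set (t := j * y + j / INR K / 2).
  assert (Hsin : forall x, sin (2 * PI * x) = cos2pi (x - / 4)).
  { intros x. unfold cos2pi.
    replace (2 * PI * (x - / 4)) with (2 * PI * x - PI / 2) by field.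
    rewrite cos_minus, cos_PI2, sin_PI2. ring. }
  rewrite !Hsin.
  replace (t + - j - / 4) with (t - / 4 + - j) by ring.
  rewrite cos2pi_int by now apply is_int_opp.
  intros E. rewrite Rminus_diag_eq in E by reflexivity.
  apply Rmult_integral in E. destruct E as [E|E]; [lra|assumption].
Qed.

(** Grid version of the integral of the kernel. It is exact because H <= K keeps every nonzero
    frequency k - l below K in absolute value, so only the diagonal survives. *)
Lemma fejer_grid_sum (H K : nat) (y : R) :
  (1 <= K)%nat -> (H <= K)%nat ->
  rsum (fun i => fejer H (y - INR i / INR K)) K = INR K * INR H.
Proof.
  intros HK HHK. unfold fejer. rewrite rsum_swap.
  rewrite (rsum_ext _ (fun _ => INR K)); [rewrite rsum_const; ring|].
  intros k Hk. rewrite rsum_swap.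
  rewrite (rsum_ext _ (fun l => INR K * (if Nat.eq_dec k l then 1 else 0))).
  - rewrite rsum_scal, rsum_delta. destruct (lt_dec k H); [ring|lia].
  - intros l Hl. destruct (Nat.eq_dec k l) as [->|Hne].
    + rewrite (rsum_ext _ (fun _ => 1)); [now rewrite rsum_const|].
      intros i _. unfold cos2pi. rewrite Rminus_diag_eq by reflexivity.
      rewrite Rmult_0_r. apply cos_0.
    + rewrite Rmult_0_r.
      rewrite (rsum_ext _ (fun i => cos2pi ((INR k - INR l) * (y - INR i / INR K))))
        by (intros; f_equal; ring).
      apply rsum_cos2pi_grid.
      * apply is_int_plus; [|apply is_int_opp]; apply is_int_INR.
      * assert (INR k - INR l <> 0)
          by (intros E; apply Hne, INR_eq; lra).
        split; [now apply Rabs_pos_lt|].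
        assert (INR k < INR K) by (apply lt_INR; lia).
        assert (INR l < INR K) by (apply lt_INR; lia).
        assert (Hk0 := pos_INR k). assert (Hl0 := pos_INR l).
        apply Rabs_def1; lra.
Qed.

Lemma sin_pi_lower_bound (eta y : R) :
  0 < eta <= / 2 -> eta <= y <= 1 - eta -> sin (PI * eta) <= sin (PI * y).
Proof.
  intros Heta Hy. assert (Hpi := PI_RGT_0).
  assert (Hle : forall z, eta <= z <= / 2 -> sin (PI * eta) <= sin (PI * z)).
  { intros z Hz. apply sin_incr_1; nra. }
  destruct (Rle_lt_dec y (/ 2)) as [H|H].
  - apply Hle; lra.
  - replace (PI * y) with (PI - PI * (1 - y)) by ring.
    rewrite sin_PI_x. apply Hle; lra.
Qed.

(* The grid points [a - eta + i / K] with [L <= i < K] stay at distance at least [eta] from [[a, b)] modulo 1, so they contribute little. *)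
Lemma ind_frac_le_fejer (H K L : nat) (a b eta x : R) :
  (1 <= H)%nat -> (H <= K)%nat -> (L <= K)%nat ->
  0 < eta <= / 2 -> INR K * (b - a + 2 * eta) <= INR L ->
  ind_frac a b x <=
    / (INR K * INR H) * rsum (fun i => fejer H (x - (a - eta) - INR i / INR K)) L
    + 2 / (INR H * sin (PI * eta) ^ 2).
Proof.
  intros HH HHK HLK Heta HL.
  assert (HHr : 1 <= INR H) by (apply (le_INR 1); lia).
  assert (HKr : 1 <= INR K) by (apply (le_INR 1); lia).
  assert (Hpi := PI_RGT_0).
  assert (Hsin : 0 < sin (PI * eta)) by (apply sin_gt_0; nra).
  assert (Hs2 : 0 < sin (PI * eta) ^ 2) by (apply pow_lt; assumption).
  assert (HKH : 0 < INR K * INR H) by nra.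
  assert (Hcst : 0 < 2 / (INR H * sin (PI * eta) ^ 2))
    by (apply Rdiv_lt_0_compat; nra).
  assert (Hpos : 0 <= / (INR K * INR H) *
            rsum (fun i => fejer H (x - (a - eta) - INR i / INR K)) L).
  { apply Rmult_le_pos; [left; now apply Rinv_0_lt_compat|].
    apply rsum_nonneg; intros; apply fejer_nonneg. }
  unfold ind_frac.
  destruct (Rle_dec a (frac_part x)) as [Ha|_]; [|lra].
  destruct (Rlt_dec (frac_part x) b) as [Hb|_]; [|lra].
  clear Hpos.
  (* The full grid carries mass K H exactly, so bounding the tail from above bounds the first L
     terms from below. *)
  assert (Htot := fejer_grid_sum H K (x - (a - eta)) ltac:(lia) HHK).
  assert (Happ := rsum_app (fun i => fejer H (x - (a - eta) - INR i / INR K)) L (K - L)).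
  replace (L + (K - L))%nat with K in Happ by lia.
  assert (Htail : rsum (fun i => fejer H (x - (a - eta) - INR (L + i) / INR K)) (K - L)
                  <= INR K * (2 / sin (PI * eta) ^ 2)).
  { apply Rle_trans with (INR (K - L) * (2 / sin (PI * eta) ^ 2)).
    - rewrite <- rsum_const. apply rsum_le; intros i Hi.
      replace (x - (a - eta) - INR (L + i) / INR K)
        with ((frac_part x - (a - eta) - INR (L + i) / INR K) + IZR (Int_part x))
        by (unfold frac_part; ring).
      rewrite fejer_int by now eexists.
      apply fejer_bound. split; [assumption|].
      assert (HiK : (INR L) <= INR (L + i) <= INR K - 1).
      { split; [apply le_INR; lia|]. change 1 with (INR 1).
        rewrite <- minus_INR by lia. apply le_INR; lia. }
      set (t := INR (L + i) / INR K).
      (* Since a <= {x} < b, this range puts t - {x} + a - eta between eta and 1 - eta. *)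
      assert (Ht : b - a + 2 * eta <= t < 1).
      { assert (Et : t * INR K = INR (L + i)) by (unfold t; field; lra).
        split; apply Rnot_lt_le || apply Rnot_le_lt; intros Hlt; nra. }
      rewrite <- Rabs_Ropp, <- sin_neg.
      apply Rle_trans with (2 := Rle_abs _).
      replace (- (PI * (frac_part x - (a - eta) - t)))
        with (PI * (t - frac_part x + a - eta)) by ring.
      apply sin_pi_lower_bound; lra.
    - apply Rmult_le_compat_r.
      + left. apply Rdiv_lt_0_compat; lra.
      + apply le_INR; lia. }
  apply Rmult_le_reg_l with (INR K * INR H); [assumption|].
  rewrite Rmult_plus_distr_l, <- Rmult_assoc, Rinv_r, Rmult_1_l by lra.
  replace (INR K * INR H * (2 / (INR H * sin (PI * eta) ^ 2)))
    with (INR K * (2 / sin (PI * eta) ^ 2)) by (field; lra).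
  lra.
Qed.

(** * From small Weyl sums to small discrepancy *)

Lemma count_in_rsum (x : nat -> R) (a b : R) (N : nat) :
  count_in x a b N = rsum (fun n => ind_frac a b (x (S n))) N.
Proof. induction N as [|N IH]; simpl; [reflexivity|]. now rewrite IH. Qed.

Lemma ind_frac_le_1 (a b x : R) : ind_frac a b x <= 1.
Proof. unfold ind_frac. destruct Rle_dec; [destruct Rlt_dec|]; lra. Qed.

Lemma count_in_le (x : nat -> R) (a b : R) (N : nat) : count_in x a b N <= INR N.
Proof.
  rewrite count_in_rsum, <- (Rmult_1_r (INR N)), <- rsum_const.
  apply rsum_le; intros; apply ind_frac_le_1.
Qed.

(** The H diagonal pairs contribute N each and every other pair at most eps N; the translation by s
    disappears into the phase c. *)
Lemma rsum_fejer_le (H N : nat) (x : nat -> R) (eps s : R) :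
  0 <= eps ->
  (forall k l, (k < H)%nat -> (l < H)%nat -> k <> l -> forall c,
     Rabs (rsum (fun n => cos2pi ((INR k - INR l) * x n + c)) N) <= eps * INR N) ->
  rsum (fun n => fejer H (x n - s)) N <= INR N * INR H * (1 + INR H * eps).
Proof.
  intros Heps Hsmall. unfold fejer. rewrite rsum_swap.
  replace (INR N * INR H * (1 + INR H * eps))
    with (rsum (fun k => rsum (fun l =>
            INR N * (if Nat.eq_dec k l then 1 else 0) + eps * INR N) H) H).
  - apply rsum_le; intros k Hk. rewrite rsum_swap.
    apply rsum_le; intros l Hl.
    assert (HN := pos_INR N).
    apply Rle_trans with (1 := Rle_abs _).
    destruct (Nat.eq_dec k l) as [->|Hne].
    + apply Rle_trans with (INR N * 1); [|nra].
      apply rsum_abs_le; intros; apply cos2pi_bound.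
    + rewrite (rsum_ext _ (fun n => cos2pi ((INR k - INR l) * x n + - (INR k - INR l) * s)))
        by (intros; f_equal; ring).
      rewrite Rmult_0_r, Rplus_0_l. now apply Hsmall.
  - rewrite (rsum_ext _ (fun _ => INR N * 1 + INR H * (eps * INR N))).
    + rewrite rsum_const. ring.
    + intros k Hk. rewrite rsum_plus, rsum_const, rsum_scal, rsum_delta.
      destruct (lt_dec k H); [reflexivity|lia].
Qed.

Lemma nat_ceil (x : R) : 0 <= x -> exists n : nat, x <= INR n <= x + 1.
Proof.
  intros Hx. destruct (archimed x) as [H1 H2].
  assert (Hup : (0 <= up x)%Z) by (apply le_IZR; lra).
  exists (Z.to_nat (up x)). rewrite INR_IZR_INZ, Z2Nat.id by assumption. lra.
Qed.

(** Budget for the excess: widening by 2 eta costs at most delta/2, rounding up to L grid points at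
    most 1/K <= delta/2, kernel leakage 2/(H s2) <= delta/2, and the Weyl sums a factor 1 + H eps =
    1 + delta/2. Finitely many frequencies suffice, their number depending on delta only. *)
Lemma count_in_upper (delta : R) :
  0 < delta -> exists (H : nat) (eps : R), 0 < eps /\
    forall (x : nat -> R) (N : nat),
    (forall k l, (k < H)%nat -> (l < H)%nat -> k <> l -> forall c,
       Rabs (rsum (fun n => cos2pi ((INR k - INR l) * x (S n) + c)) N) <= eps * INR N) ->
    forall a b, 0 <= a -> a <= b -> b <= 1 ->
      count_in x a b N <= INR N * (b - a + 2 * delta).
Proof.
  intros Hdelta.
  set (eta := Rmin (delta / 4) (/ 2)).
  assert (Heta : 0 < eta <= / 2)
    by (split; [apply Rmin_pos; lra|apply Rmin_r]).
  assert (Heta' : eta <= delta / 4) by apply Rmin_l.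
  assert (Hpi := PI_RGT_0).
  assert (Hsin : 0 < sin (PI * eta)) by (apply sin_gt_0; nra).
  assert (Hs2 : 0 < sin (PI * eta) ^ 2) by (apply pow_lt; assumption).
  set (s2 := sin (PI * eta) ^ 2) in *.
  destruct (nat_upper_bound (4 / (s2 * delta))) as (H & HH1 & HH).
  destruct (nat_upper_bound (INR H + 2 / delta)) as (K & HK1 & HK).
  assert (HHr : 1 <= INR H) by (apply (le_INR 1); lia).
  assert (H2d : 0 < 2 / delta) by (apply Rdiv_lt_0_compat; lra).
  assert (HHK : (H <= K)%nat) by (apply INR_le; lra).
  assert (HKr : 1 <= INR K) by lra.
  exists H, (delta / (2 * INR H)).
  assert (Heps : 0 < delta / (2 * INR H)) by (apply Rdiv_lt_0_compat; lra).
  split; [assumption|].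
  intros x N Hsmall a b Ha Hab Hb.
  assert (HN := pos_INR N).
  destruct (nat_ceil (INR K * (b - a + 2 * eta))) as [L HL]; [nra|].
  assert (HLK : INR L / INR K <= b - a + delta).
  { apply Rmult_le_reg_r with (INR K); [lra|].
    replace (INR L / INR K * INR K) with (INR L) by (field; lra).
    assert (HKd : 2 <= INR K * delta).
    { replace 2 with (2 / delta * delta) by (field; lra).
      apply Rmult_le_compat_r; lra. }
    nra. }
  (* Beyond 1 the trivial count N is enough. Otherwise L <= K, and the factor 1 + delta/2 adds at
     most delta/2. *)
  destruct (Rlt_le_dec 1 (b - a + delta)) as [Hbig|Hle].
  { apply Rle_trans with (1 := count_in_le x a b N). nra. }
  assert (HLK' : (L <= K)%nat).
  { apply INR_le. apply Rmult_le_reg_r with (/ INR K).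
    - apply Rinv_0_lt_compat; lra.
    - rewrite Rinv_r by lra. unfold Rdiv in HLK. lra. }
  rewrite count_in_rsum.
  apply Rle_trans with (1 := rsum_le _ _ N (fun n _ =>
    ind_frac_le_fejer H K L a b eta (x (S n)) HH1 HHK HLK' Heta (proj1 HL))).
  rewrite rsum_plus, rsum_const, rsum_scal, rsum_swap.
  assert (Hmain : rsum (fun i => rsum (fun n =>
             fejer H (x (S n) - (a - eta) - INR i / INR K)) N) L
           <= INR L * (INR N * INR H * (1 + INR H * (delta / (2 * INR H))))).
  { rewrite <- rsum_const. apply rsum_le; intros i Hi.
    rewrite (rsum_ext _ (fun n => fejer H (x (S n) - ((a - eta) + INR i / INR K))))
      by (intros; f_equal; ring).
    apply (rsum_fejer_le H N (fun n => x (S n))); [lra|assumption]. }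
  apply Rle_trans with
    (/ (INR K * INR H) *
       (INR L * (INR N * INR H * (1 + INR H * (delta / (2 * INR H))))) +
     INR N * (2 / (INR H * s2))).
  { apply Rplus_le_compat_r, Rmult_le_compat_l; [|assumption].
    left. apply Rinv_0_lt_compat. nra. }
  replace (/ (INR K * INR H) *
       (INR L * (INR N * INR H * (1 + INR H * (delta / (2 * INR H))))) +
     INR N * (2 / (INR H * s2)))
    with (INR N * (INR L / INR K * (1 + delta / 2) + 2 / (INR H * s2)))
    by (field; lra).
  apply Rmult_le_compat_l; [assumption|].
  assert (Hc : 2 / (INR H * s2) <= delta / 2).
  { assert (Hd : 0 < s2 * delta) by nra.
    assert (E : 4 <= INR H * (s2 * delta)).
    { replace 4 with (4 / (s2 * delta) * (s2 * delta)) by (field; lra).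
      apply Rmult_le_compat_r; lra. }
    apply Rmult_le_reg_r with (INR H * s2); [nra|].
    replace (2 / (INR H * s2) * (INR H * s2)) with 2 by (field; lra). lra. }
  nra.
Qed.

Lemma ind_frac_partition (a b x : R) :
  0 <= a -> a <= b -> b <= 1 ->
  ind_frac 0 a x + ind_frac a b x + ind_frac b 1 x = 1.
Proof.
  intros Ha Hab Hb. unfold ind_frac. destruct (base_fp x) as [H0 H1].
  repeat match goal with
         | |- context [Rle_dec ?u ?v] => destruct (Rle_dec u v)
         | |- context [Rlt_dec ?u ?v] => destruct (Rlt_dec u v)
         end; lra.
Qed.

Lemma count_in_partition (x : nat -> R) (a b : R) (N : nat) :
  0 <= a -> a <= b -> b <= 1 ->
  count_in x 0 a N + count_in x a b N + count_in x b 1 N = INR N.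
Proof.
  intros Ha Hab Hb. rewrite !count_in_rsum, <- !rsum_plus.
  rewrite (rsum_ext _ (fun _ => 1)); [rewrite rsum_const; ring|].
  intros n _. now apply ind_frac_partition.
Qed.

(** Upper bounds give the lower one through the complement: [0,a) and [b,1) each exceed their share
    by at most 2 delta N, so [a,b) falls short by at most 4 delta N. *)
Lemma discrepancy_le (delta : R) (x : nat -> R) (N : nat) :
  0 < delta -> (1 <= N)%nat ->
  (forall a b, 0 <= a -> a <= b -> b <= 1 ->
     count_in x a b N <= INR N * (b - a + 2 * delta)) ->
  discrepancy N x <= 4 * delta.
Proof.
  intros Hdelta HN1 Hup. unfold discrepancy.
  match goal with |- real (Lub_Rbar ?E) <= _ =>
    destruct (Lub_Rbar_correct E) as [_ Hlub]; revert Hlub;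
    generalize (Lub_Rbar E) end.
  intros l Hlub.
  assert (Hl : Rbar_le l (4 * delta)).
  { apply Hlub. intros r (a & b & Ha & Hab & Hb & ->). simpl.
    assert (HN : 1 <= INR N) by (apply (le_INR 1); lia).
    assert (H1 := Hup a b Ha Hab Hb).
    assert (H2 := Hup 0 a ltac:(lra) Ha ltac:(lra)).
    assert (H3 := Hup b 1 ltac:(lra) Hb ltac:(lra)).
    assert (H4 := count_in_partition x a b N Ha Hab Hb).
    replace (count_in x a b N / INR N - (b - a))
      with (/ INR N * (count_in x a b N - INR N * (b - a))) by (field; lra).
    rewrite Rabs_mult, Rabs_pos_eq by (left; apply Rinv_0_lt_compat; lra).
    apply Rmult_le_reg_l with (INR N); [lra|].
    rewrite <- Rmult_assoc, Rinv_r, Rmult_1_l by lra.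
    assert (0 <= INR N * delta) by nra.
    apply Rabs_le; lra. }
  (* [Hl] excludes [p_infty], and [real] sends [m_infty] to 0, which is below 4 delta. *)
  destruct l as [l| |]; simpl in *; [assumption|contradiction|lra].
Qed.

Lemma poly_eval_scal (c : R) (alpha : nat -> R) (d : nat) (x : R) :
  poly_eval (fun k => c * alpha k) d x = c * poly_eval alpha d x.
Proof. induction d as [|d IH]; simpl; [ring|rewrite IH; ring]. Qed.

(** A denominator q for all coefficients of (k - l)P gives |k - l| q for those of P, whence the
    factor H in the bound; the successor keeps it positive. *)
Lemma poly_discrepancy_or_bounded_denominators (delta : R) (d : nat) :
  0 < delta -> exists M : nat, (1 <= M)%nat /\ forall alpha : nat -> R,
    (exists N0, forall N, (N0 <= N)%nat ->
       discrepancy N (fun n => poly_eval alpha d (INR n)) <= 4 * delta) \/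
    exists q : nat, (1 <= q <= M)%nat /\
      forall k, (1 <= k <= d)%nat -> is_int (INR q * alpha k).
Proof.
  intros Hdelta.
  destruct (count_in_upper delta Hdelta) as (H & eps & Heps & Hcount).
  destruct (weyl_poly d 1 (eps / 4)) as [M HM]; [lra|].
  exists (S (H * M)). split; [lia|]. intros alpha.
  destruct (classic (exists q : nat, (1 <= q <= S (H * M))%nat /\
      forall k, (1 <= k <= d)%nat -> is_int (INR q * alpha k))) as [?|Hno];
    [now right|left].
  assert (Hsm : forall k, (k < H)%nat -> exists N0, forall N, (N0 <= N)%nat ->
    forall l, (l < H)%nat -> k <> l -> forall c,
      Rabs (rsum (fun n => cos2pi ((INR k - INR l) *
              poly_eval alpha d (INR (S n)) + c)) N) <= eps * INR N).
  { intros k Hk.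
    destruct (eventually_forall_lt (fun l N => k <> l -> forall c,
      Rabs (rsum (fun n => cos2pi ((INR k - INR l) *
              poly_eval alpha d (INR (S n)) + c)) N) <= eps * INR N) H)
      as [N1 HN1].
    - intros l Hl. destruct (Nat.eq_dec k l) as [->|Hne].
      { exists O; intros N _ Hll; now elim Hll. }
      destruct (HM (fun i => (INR k - INR l) * alpha i) (fun _ => 0) 1%nat)
        as [[N1 HN1]|(q & Hq & Hqi)].
      + lia.
      + intros n. exists 0%Z. ring.
      (* The points start at n = 1 but Weyl sums at n = 0: N + 1 terms are summed and the first
         removed, and eps (N + 1)/4 + 1 <= eps N once 2 <= eps N and N >= 1. *)
      + destruct (nat_upper_bound (2 / eps)) as (N2 & HN21 & HN2).
        exists (N1 + N2)%nat. intros N HN _ c.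
        specialize (HN1 (S N) ltac:(lia) c).
        rewrite (rsum_ext _ (fun n => cos2pi ((INR k - INR l) *
              poly_eval alpha d (INR n) + c))) in HN1
          by (intros; rewrite poly_eval_scal; f_equal; ring).
        rewrite rsum_succ_l in HN1.
        match type of HN1 with Rabs (?u + ?v) <= _ =>
          assert (Hu : Rabs u <= 1) by apply cos2pi_bound;
          replace v with ((u + v) + - u) by ring;
          apply Rle_trans with (1 := Rabs_triang _ _); rewrite Rabs_Ropp end.
        assert (HNN : INR N2 <= INR N) by (apply le_INR; lia).
        assert (1 <= INR N2) by (apply (le_INR 1); lia).
        assert (2 <= eps * INR N).
        { replace 2 with (eps * (2 / eps)) by (field; lra).
          apply Rmult_le_compat_l; lra. }
        rewrite S_INR in HN1.
        assert (eps * 1 <= eps * INR N) by (apply Rmult_le_compat_l; lra).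
        lra.
      + exfalso. apply Hno.
        assert (Hkl : exists j : nat, (1 <= j <= H)%nat /\
                  (INR k - INR l = INR j \/ INR k - INR l = - INR j)).
        { destruct (Nat.lt_ge_cases l k).
          - exists (k - l)%nat. split; [lia|]. left. rewrite minus_INR by lia. ring.
          - exists (l - k)%nat. split; [lia|]. right. rewrite minus_INR by lia. ring. }
        destruct Hkl as (j & Hj & Hjkl).
        exists (j * q)%nat. split; [nia|]. intros i Hi.
        specialize (Hqi i Hi). rewrite mult_INR.
        destruct Hjkl as [E|E]; rewrite E in Hqi.
        * replace (INR j * INR q * alpha i)
            with (INR q * (INR j * alpha i)) by ring. assumption.
        * apply is_int_opp_iff.
          replace (- (INR j * INR q * alpha i))
            with (INR q * (- INR j * alpha i)) by ring. assumption.
    - exists N1. intros N HN l Hl. now apply HN1. }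
  destruct (eventually_forall_lt _ _ Hsm) as [N0 HN0].
  exists (S N0). intros N HN. apply discrepancy_le; [assumption|lia|].
  apply Hcount. intros k l Hk Hl Hne c. apply HN0; trivial; lia.
Qed.

(** * Reduced fractions and the conclusion *)

Lemma coprime_fraction (q : nat) (x : R) :
  (1 <= q)%nat -> is_int (INR q * x) ->
  exists p r : Z, Z.gcd p r = 1%Z /\ (1 <= r <= Z.of_nat q)%Z /\ x = IZR p / IZR r.
Proof.
  intros Hq [z Hz]. rewrite INR_IZR_INZ in Hz.
  assert (Hn : (1 <= Z.of_nat q)%Z) by lia.
  revert Hz Hn. generalize (Z.of_nat q). intros n Hz Hn.
  destruct (Z.gcd_divide_l z n) as [p Hp]. destruct (Z.gcd_divide_r z n) as [r Hr].
  assert (Hg : (1 <= Z.gcd z n)%Z).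
  { assert (Z.gcd z n <> 0%Z) by (intros E; apply Z.gcd_eq_0_r in E; lia).
    generalize (Z.gcd_nonneg z n); lia. }
  exists p, r.
  assert (Hgcd : (Z.gcd p r * Z.gcd z n = Z.gcd z n)%Z).
  { rewrite Z.mul_comm, <- Z.gcd_mul_mono_l_nonneg by lia.
    rewrite !(Z.mul_comm (Z.gcd z n)), <- Hp, <- Hr. reflexivity. }
  revert Hp Hr Hg Hgcd. generalize (Z.gcd z n). intros g Hp Hr Hg Hgcd.
  assert (Hr1 : (1 <= r <= n)%Z) by nia.
  split; [nia|]. split; [assumption|].
  subst z n. rewrite !mult_IZR in Hz.
  assert (1 <= IZR g) by now apply IZR_le.
  assert (1 <= IZR r) by now apply IZR_le.
  apply Rmult_eq_reg_l with (IZR r * IZR g); [|nra].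
  rewrite Hz. field. lra.
Qed.

Theorem theorem5 (delta : R) (d : nat) :
  0 < delta -> (1 <= d)%nat ->
  exists M : nat, (1 <= M)%nat /\
    forall alpha : nat -> R,
      alpha d <> 0 ->
      (exists N0 : nat, forall N : nat, (N0 <= N)%nat ->
         forall eta : nat -> R,
           (forall n : nat, (1 <= n <= N)%nat -> Rabs (eta n) <= delta) ->
           discrepancy N (fun n => poly_eval alpha d (INR n) + eta n) > 4 * delta) ->
      exists N1 : nat, forall N : nat, (N1 <= N)%nat ->
        forall k : nat, (1 <= k <= d)%nat ->
          exists p q : Z,
            Z.gcd p q = 1%Z /\ (1 <= q <= Z.of_nat M)%Z /\
            Rabs (alpha k - IZR p / IZR q) <=
              Rpower (INR N) (- (INR (fact (k + 2)) / (2 * INR (fact (d + 2))))).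
Proof.
  intros Hdelta Hd.
  destruct (poly_discrepancy_or_bounded_denominators delta d Hdelta) as (M & HM1 & HM).
  exists M. split; [assumption|]. intros alpha _ [N0 HN0].
  destruct (HM alpha) as [[N1 HN1]|(q & Hq & Hqi)].
  - exfalso.
    specialize (HN1 (N0 + N1)%nat ltac:(lia)).
    specialize (HN0 (N0 + N1)%nat ltac:(lia) (fun _ => 0)).
    assert (Hlt : discrepancy (N0 + N1) (fun n => poly_eval alpha d (INR n) + 0)
                  > 4 * delta)
      by (apply HN0; intros; rewrite Rabs_R0; lra).
    assert (E : discrepancy (N0 + N1) (fun n => poly_eval alpha d (INR n) + 0) =
                discrepancy (N0 + N1) (fun n => poly_eval alpha d (INR n))).
    (* The two sequences agree only pointwise, so the equality is carried through the counts. *)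
    { unfold discrepancy. f_equal. apply Lub_Rbar_eqset. intros r.
      assert (Ec : forall a b,
        count_in (fun n => poly_eval alpha d (INR n) + 0) a b (N0 + N1) =
        count_in (fun n => poly_eval alpha d (INR n)) a b (N0 + N1)).
      { intros a b. rewrite !count_in_rsum. apply rsum_ext; intros.
        now rewrite Rplus_0_r. }
      split; intros (a & b & Hab); exists a, b; revert Hab; now rewrite Ec. }
    lra.
  (* The fraction equals [alpha k] exactly, and [Rpower] is an exponential, hence positive even at N
     = 0. *)
  - exists O. intros N _ k Hk.
    destruct (coprime_fraction q (alpha k)) as (p & r & Hg & Hr & E);
      [lia|now apply Hqi|].
    exists p, r. split; [assumption|]. split; [lia|].
    rewrite <- E, Rminus_diag_eq, Rabs_R0 by reflexivity.
    left. apply exp_pos.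
Qed.
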